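(* Let $q\geq 4$ be an even natural number. Then there exists a subset $U$ of the vertices of the Hamming graph $H(3,q)$ of size $|U|=\frac{5}{4}q^{2}$ such that the VC-dimension of $(U,n(U))$ is $1$.
   Context: The Hamming graph $H(3,q)$ has vertex set $\mathbb Z_q^3$, with two vertices adjacent if and only if they differ in exactly one coordinate. For a vertex $x$, $n(x)$ denotes its neighborhood, the set of vertices adjacent to $x$ (so $x\notin n(x)$), and for a set $U$ of vertices $n(U)=\{n(u):u\in U\}$. A set $W\subseteq U$ is shattered by $n(U)$ if for every $S\subseteq W$ there is $u\in U$ with $n(u)\cap W=S$. The VC-dimension of $(U,n(U))$ is the size of the largest $W\subseteq U$ that is shattered by $n(U)$. *)

(* Defs.v *)
From mathcomp Require Import all_boot all_order all_algebra.

Set Implicit Arguments.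
Unset Strict Implicit.
Unset Printing Implicit Defensive.

(* [Hvertex d q] is Z_q^d; as ['Z_q] has [q] elements only when [1 < q], the
   definitions below are meant for [1 < q]. *)
Definition Hvertex (d q : nat) : finType := 'rV['Z_q]_d.

Definition Hadj (d q : nat) : rel (Hvertex d q) :=
  fun x y => #|[set i : 'I_d | x ord0 i != y ord0 i]| == 1.

Section SetSystems.
Variable T : finType.

Definition nbhd (e : rel T) (x : T) : {set T} := [set y | e x y].

Definition nbhds (e : rel T) (U : {set T}) : {set {set T}} :=
  [set nbhd e u | u in U].

Definition shattered (F : {set {set T}}) (W : {set T}) : bool :=
  [forall (S : {set T} | S \subset W), exists A in F, A :&: W == S].

(* By the convention of [\max], this is 0 when not even [set0] is shattered,
   i.e. when [F] is empty. *)
Definition VCdim (U : {set T}) (F : {set {set T}}) : nat :=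
  \max_(W : {set T} | (W \subset U) && shattered F W) #|W|.

End SetSystems.

(* Main.v *)
(* Write q = 2k and identify Z_q with {0,1} x Z_k through v |-> (v / k, v mod k).
   Place a copy of the Latin square {(r, s, r + s)} of Z_k^3 in each of the five
   blocks 000, 100, 010, 001, 111 of {0,1}^3. Two vertices of a Latin square that
   agree in two coordinates are equal, so the induced graph is a disjoint union
   of k^2 copies of the subgraph of the 3-cube induced on the five blocks: a star
   with three leaves and an isolated vertex. There two distinct vertices with a
   common neighbour are leaves of one star and have the same neighbourhood, so no
   pair is shattered. *)
Require Import Defs.
From mathcomp Require Import all_boot all_order all_algebra.
From mathcomp Require Import zify ring.
Import GRing.Theory.

(** If a shattered [W] contained [x != y], some [u] would be adjacent to all of [W] and some [v] to
    [x] alone within [W], which the twin hypothesis forbids. The singleton of [b] is shattered: [a]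
    cuts out [b], and [b] itself cuts out the empty set. *)
Lemma VCdim_nbhds_eq1 (T : finType) (e : rel T) (U : {set T}) (a b : T) :
  (forall x y u v, x \in U -> y \in U -> u \in U -> v \in U ->
     x != y -> e u x -> e u y -> e v x -> e v y) ->
  a \in U -> b \in U -> e a b -> ~~ e b b ->
  VCdim U (nbhds e U) = 1.
Proof.
move=> twins aU bU eab nebb; apply/eqP; rewrite eqn_leq; apply/andP; split.
  apply/bigmax_leqP => W /andP[/subsetP WU /forall_inP shW].
  rewrite leqNgt; apply/negP => /card_gt1P[x [y [xW yW neq_xy]]].
  have [_ /imsetP[u uU ->] /eqP uW] := exists_inP (shW W (subxx W)).
  have [|_ /imsetP[v vU ->] /eqP vx] := exists_inP (shW [set x] _).
    by rewrite sub1set.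
  have eu z : z \in W -> e u z by rewrite -{1}uW !inE => /andP[].
  have evx : e v x by have := set11 x; rewrite -vx !inE => /andP[].
  have evy := twins x y u v (WU _ xW) (WU _ yW) uU vU neq_xy (eu _ xW) (eu _ yW) evx.
  have : y \in [set x] by rewrite -vx !inE evy.
  by rewrite inE eq_sym (negPf neq_xy).
rewrite -(cards1 b); apply: leq_bigmax_cond; rewrite sub1set bU /=.
apply/forall_inP => S; rewrite subset1 => /orP[] /eqP->; apply/exists_inP.
  exists (nbhd e a); first exact: imset_f.
  by apply/eqP/setIidPr; rewrite sub1set inE.
exists (nbhd e b); first exact: imset_f.
by apply/eqP/setP => z; rewrite !inE; case: eqP => [->|]; rewrite ?andbF ?andbT // (negPf nebb).
Qed.

(* [None] is the block 000, [Some None] is 111 and [Some (Some i)] is the unit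
   vector e_i. *)
Definition block : finType := option (option 'I_3).

Definition bit (t : block) (i : 'I_3) : bool :=
  match t with
  | None => false
  | Some None => true
  | Some (Some j) => i == j
  end.

Definition star_edge (t t' : block) : bool :=
  match t, t' with
  | None, Some (Some _) | Some (Some _), None => true
  | _, _ => false
  end.

Lemma forall_I3 (P : 'I_3 -> Prop) :
  P (inord 0) -> P (inord 1) -> P (inord 2) -> forall i, P i.
Proof.
move=> P0 P1 P2 i; rewrite -(inord_val i).
by case: i => [[|[|[|//]]] /=].
Qed.

Lemma card_I3 (P : pred 'I_3) :
  #|[set i | P i]| = P (inord 0) + P (inord 1) + P (inord 2).
Proof.
rewrite cardsE -sum1_card big_mkcond /= !big_ord_recl big_ord0 addn0 addnA.
rewrite !unfold_in.
have -> : ord0 = inord 0 :> 'I_3 by apply: val_inj; rewrite /= inordK.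
have -> : lift (inord 0) ord0 = inord 1 :> 'I_3.
  by apply: val_inj; rewrite /= /bump !inordK.
have -> : lift (inord 0) (lift ord0 ord0) = inord 2 :> 'I_3.
  by apply: val_inj; rewrite /= /bump !inordK.
by do 3!case: (P _).
Qed.

Lemma eq_inord3 (a b : nat) : a < 3 -> b < 3 ->
  ((inord a : 'I_3) == inord b) = (a == b).
Proof. by move=> a3 b3; rewrite -val_eqE /= !inordK. Qed.

Lemma bit_inj (t t' : block) : bit t =1 bit t' -> t = t'.
Proof.
move=> eq_t; have := (eq_t (inord 0), eq_t (inord 1), eq_t (inord 2)); clear eq_t.
case: t => [[i|]|]; case: t' => [[j|]|] //=;
  try (elim/forall_I3: i); try (elim/forall_I3: j);
  by rewrite ?eq_inord3 //=; case; case.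
Qed.

(** Unit vectors are at distance 1 from 000 and 2 from each other; 111 is at distance 2 from them
    and 3 from 000. *)
Lemma card_bit_neq (t t' : block) :
  (#|[set i | bit t i != bit t' i]| == 1) = star_edge t t'.
Proof.
rewrite card_I3.
case: t => [[i|]|]; case: t' => [[j|]|] //=;
  try (elim/forall_I3: i); try (elim/forall_I3: j);
  by rewrite ?eq_inord3.
Qed.

Lemma star_edge_twins (t t' u v : block) :
  t != t' -> star_edge u t -> star_edge u t' -> star_edge v t -> star_edge v t'.
Proof.
by case: t => [[i|]|]; case: t' => [[j|]|]; case: u => [[?|]|]; case: v => [[?|]|].
Qed.

Section Construction.
Variable k : nat.
Hypothesis k_gt0 : 0 < k.

Definition latin (c : 'I_k * 'I_k) (i : 'I_3) : nat :=
  match val i with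
  | 0 => c.1
  | 1 => c.2
  | _ => (c.1 + c.2) %% k
  end.

Lemma ltn_latin c i : latin c i < k.
Proof. by rewrite /latin; case: (val i) => [|[|n]]; rewrite ?ltn_ord ?ltn_pmod. Qed.

(** Any two of [r], [s], [r + s] determine the third, by cancellation modulo [k]. *)
Lemma latin_two_coords c c' (i0 : 'I_3) :
  (forall i, i != i0 -> latin c i = latin c' i) -> c = c'.
Proof.
move=> agree.
have agreeE n : n < 3 -> n != i0 -> latin c (inord n) = latin c' (inord n).
  by move=> n3 ni; apply: agree; rewrite -val_eqE /= inordK.
have cancel (a b d : 'I_k) : (a + b) %% k = (a + d) %% k -> b = d.
  move/eqP; rewrite eqn_modDl !modn_small ?ltn_ord //.
  by move/eqP/val_inj.
move: agreeE; rewrite /latin; case: c c' {agree} => [r s] [r' s'] /=.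
case: i0 => [[|[|[|//]]] _] /= agreeE.
- move: (agreeE 1 isT isT) (agreeE 2 isT isT); rewrite !inordK //= => /val_inj <-.
  by rewrite ![_ + s]addnC => /cancel <-.
- move: (agreeE 0 isT isT) (agreeE 2 isT isT); rewrite !inordK //= => /val_inj <-.
  by move=> /cancel <-.
- move: (agreeE 0 isT isT) (agreeE 1 isT isT); rewrite !inordK //=.
  by move=> /val_inj <- /val_inj <-.
Qed.

Definition vertex (p : block * ('I_k * 'I_k)) : Hvertex 3 k.*2 :=
  (\row_i inZp (bit p.1 i * k + latin p.2 i)%N)%R.

(** Since [latin] is below [k], the value [bit * k + latin] stays below [2k], so [inZp] does not
    reduce it and division by [k] recovers both parts. *)
Lemma vertex_coord p p' i :
  (vertex p ord0 i == vertex p' ord0 i) =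
  (bit p.1 i == bit p'.1 i) && (latin p.2 i == latin p'.2 i).
Proof.
have := ltn_latin p.2 i; have := ltn_latin p'.2 i.
rewrite !mxE -val_eqE /= Zp_cast; last by lia.
by move=> lt' lt; rewrite !modn_small; case: (bit _ _); lia.
Qed.

Lemma vertex_inj : injective vertex.
Proof.
move=> [t c] [t' c'] eq_v.
have eqi i : bit t i = bit t' i /\ latin c i = latin c' i.
  have := vertex_coord (t, c) (t', c') i; rewrite eq_v eqxx /=.
  by case/esym/andP => /eqP -> /eqP ->.
congr (_, _); first by apply: bit_inj => i; case: (eqi i).
(* All three coordinates agree, so the exempted index [ord0] is arbitrary. *)
by apply: (@latin_two_coords _ _ ord0) => i _; case: (eqi i).
Qed.

Lemma Hadj_vertex p p' :
  Hadj (vertex p) (vertex p') = (p.2 == p'.2) && star_edge p.1 p'.1.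
Proof.
rewrite /Hadj -card_bit_neq.
case: (eqVneq p.2 p'.2) => [eq_c | neq_c] /=.
  congr (_ == 1); apply: eq_card => i.
  by rewrite !inE vertex_coord eq_c eqxx andbT.
(* Vertices differing only at [i0] have Latin parts agreeing at the other two coordinates, hence
   equal. *)
apply/negP => /cards1P[i0 diff]; case/eqP: neq_c.
apply: (@latin_two_coords _ _ i0) => i; rewrite -in_set1 -diff inE negbK.
by rewrite vertex_coord => /andP[_ /eqP].
Qed.

Definition star_family : {set Hvertex 3 k.*2} := vertex @: setT.

Lemma card_star_family : #|star_family| = 5 * k ^ 2.
Proof.
by rewrite card_imset ?cardsT; [rewrite !card_prod !card_option !card_ord | exact: vertex_inj].
Qed.

Lemma VCdim_star_family : VCdim star_family (nbhds (@Hadj 3 k.*2) star_family) = 1.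
Proof.
(* Any cell would do: the required edge joins the centre 000 to a leaf of the star over [c]. *)
pose c := (Ordinal k_gt0, Ordinal k_gt0).
apply: (@VCdim_nbhds_eq1 _ _ _ (vertex (None, c)) (vertex (Some (Some ord0), c))).
- move=> x y u v /imsetP[[t1 c1] _ ->] /imsetP[[t2 c2] _ ->].
  move=> /imsetP[[t3 c3] _ ->] /imsetP[[t4 c4] _ ->].
  (* Adjacency puts all four vertices over the same cell, so [x != y] forces distinct blocks and the
     claim reduces to a single star. *)
  rewrite !Hadj_vertex /= => neq /andP[/eqP c31 e31] /andP[/eqP c32 e32] /andP[/eqP -> e41].
  rewrite -c31 c32 eqxx; apply: (star_edge_twins t1 t2 t3 t4) => //.
  by apply: contraNneq neq => ->; rewrite -c31 c32.
- exact: imset_f.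
- exact: imset_f.
- by rewrite Hadj_vertex eqxx.
- by rewrite Hadj_vertex eqxx.
Qed.

End Construction.

Theorem proposition1p5 (q : nat) (hq4 : 4 <= q) (hq : ~~ odd q) :
  exists U : {set Hvertex 3 q},
    (#|U|%:R = 5%:R / 4%:R * q%:R ^+ 2 :> rat)%R /\
    VCdim U (nbhds (@Hadj 3 q) U) = 1.
Proof.
have k_gt0 : 0 < q./2 by lia.
(* Writing [q] as [q./2.*2] makes the ambient type that of [star_family]. *)
rewrite -(even_halfK hq); exists (star_family q./2); split; last exact: VCdim_star_family.
rewrite card_star_family // -mul2n !natrM.
by field.
Qed.
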